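(* Consider the $N$-agent game and the first-order asynchronous algorithm described in the context. Assume: (1) (Partial asynchronism) each agent $i$ updates at least once in every time interval of length $B$, i.e. $\mathbb{T}^i\cap[t,t+B)\neq\emptyset$ for all integers $t\ge 1$ and all $i=1,\dots,N$, where $B\ge 1$ is an integer. (2) (Quasidominance) for each $i$, $C_i(x_i,x_{-i})$ is $\mu_i$-strongly convex in $x_i\in\mathcal{X}_i$ for every $x_{-i}$ (with $\mu_i>0$), and for each $j=1,\dots,N$ (including $j=i$) the map $x\mapsto\nabla_i C_i(x)$ is $L_{ij}$-Lipschitz in $x_j$ (the other coordinates being fixed); moreover there is a vector $r=(r_1,\dots,r_N)$ with all $r_i>0$ such that $r_i\mu_i>\sum_{j\ne i}r_jL_{ij}$ for all $i=1,\dots,N$. (3) (Bounded gradients) $\|\nabla_i C_i(x)\|\le U$ for all $x\in\mathcal{X}$ and all $i=1,\dots,N$. Let $\varepsilon:=\min_i\big\{\mu_i-\frac{1}{r_i}\sum_{j\ne i}r_jL_{ij}\big\}>0$ and run the algorithm with constant step size $\eta=\frac{B\ln(T/B)}{\varepsilon T}$. Then $$\max_i\|x_{i,T}-x_i^*\|^2=\mathcal{O}\Big(\frac{B^3\ln(T/B)}{T}\Big),$$ where $x^*=(x_1^*,\dots,x_N^* )$ is the unique Nash equilibrium. That is, there is a constant $c>0$, depending only on the game data ($N$, $D$, $U$, the $\mu_i$, $L_{ij}$ and $r_i$) and not on $T$, $B$, the update sets $\mathbb{T}^i$ or the initial point, such that for all integers $B\ge 1$ and $T\ge 2B$ and all update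 sets satisfying (1), $\max_i\|x_{i,T}-x_i^*\|^2\le c\,\frac{B^3\ln(T/B)}{T}$.
   Context: Game. There are $N$ agents. Agent $i$ chooses an action $x_i$ in a closed convex set $\mathcal{X}_i\subseteq\mathbb{R}^d$; each $\mathcal{X}_i$ contains the ball of radius $R>0$ centered at the origin and has diameter at most $D>0$. Put $\mathcal{X}=\prod_{i=1}^N\mathcal{X}_i$. Agent $i$ has a real-valued cost function $C_i(x)=C_i(x_i,x_{-i})$ on $\mathcal{X}$, differentiable in $x_i$, where $x_{-i}$ denotes the actions of all agents other than $i$; $\nabla_iC_i$ denotes the gradient of $C_i$ with respect to $x_i$. A Nash equilibrium is a point $x^*\in\mathcal{X}$ with $C_i(x_i^*,x_{-i}^* )\le C_i(x_i,x_{-i}^* )$ for all $x_i\in\mathcal{X}_i$ and all $i$; under the quasidominance assumption it exists and is unique. Asynchronous updates. For each $i$, $\mathbb{T}^i\subseteq\{1,2,\dots\}$ is a given set of time steps; $t\in\mathbb{T}^i$ means agent $i$ changes its action between time $t$ and time $t+1$. First-order asynchronous algorithm. Starting from $x_{i,1}\in\mathcal{X}_i$, for $t=1,2,\dots$, with $x_t=(x_{1,t},\dots,x_{N,t})$, $$x_{i,t+1}=\begin{cases}\mathcal{P}_{\mathcal{X}_i}\big(x_{i,t}-\eta\nabla_iC_i(x_t)\big), & t\in\mathbb{T}^i,\\ x_{i,t}, & \text{otherwise},\end{cases}$$ where $\mathcal{P}_{\mathcal{X}_i}$ is the Euclidean projection onto $\mathcal{X}_i$ and $\eta>0$ is a constant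 step size. *)

(* Defs.v *)
From HB Require Import structures.
From mathcomp Require Import all_boot all_order all_algebra.
From mathcomp Require Import all_classical all_reals all_analysis.
Import Order.TTheory GRing.Theory Num.Theory.
Import numFieldNormedType.Exports.

Set Implicit Arguments.
Unset Strict Implicit.
Unset Printing Implicit Defensive.

Local Open Scope classical_set_scope.
Local Open Scope ring_scope.

(* The library norm on 'rV[R]_d is the sup norm, so the Euclidean structure is
   defined here; both norms induce the library topology used by [closed] and
   [nbhs]. *)
Definition dotv (R : realType) (d : nat) (u v : 'rV[R]_d) : R :=
  \sum_(k < d) u ord0 k * v ord0 k.

Definition enorm (R : realType) (d : nat) (u : 'rV[R]_d) : R :=
  Num.sqrt (dotv u u).

Definition is_proj (R : realType) (d : nat) (K : set 'rV[R]_d)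
    (y p : 'rV[R]_d) : Prop :=
  K p /\ forall z, K z -> enorm (p - y) <= enorm (z - y).

Definition profile (R : realType) (N d : nat) : Type := 'I_N -> 'rV[R]_d.

Definition upd (R : realType) (N d : nat) (x : profile R N d) (i : 'I_N)
    (y : 'rV[R]_d) : profile R N d :=
  [eta x with i |-> y].

Definition joint (R : realType) (N d : nat) (X : 'I_N -> set 'rV[R]_d) :
    set (profile R N d) :=
  [set x | forall i, X i (x i)].

Definition nash (R : realType) (N d : nat) (X : 'I_N -> set 'rV[R]_d)
    (C : 'I_N -> profile R N d -> R) (x : profile R N d) : Prop :=
  joint X x /\ forall i y, X i y -> C i x <= C i (upd x i y).

(* Costs are total functions, but only their values on [joint X] are ever
   used: the differential is taken along X i only.  When X i is convex with
   nonempty interior (as in the games below) such a g is unique, also at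
   boundary points of X i. *)
Definition is_pgradient (R : realType) (N d : nat) (X : 'I_N -> set 'rV[R]_d)
    (C : 'I_N -> profile R N d -> R) (i : 'I_N) (x : profile R N d)
    (g : 'rV[R]_d) : Prop :=
  forall e : R, 0 < e ->
    \forall y \near x i, X i y ->
      `|C i (upd x i y) - C i x - dotv g (y - x i)| <= e * enorm (y - x i).

Definition strongly_convex_on (R : realType) (d : nat) (K : set 'rV[R]_d)
    (m : R) (f : 'rV[R]_d -> R) : Prop :=
  forall (y z : 'rV[R]_d) (t : R), K y -> K z -> 0 <= t <= 1 ->
    f (t *: y + (1 - t) *: z) <=
      t * f y + (1 - t) * f z - m / 2 * t * (1 - t) * enorm (y - z) ^+ 2.

Definition lipschitz_in (R : realType) (N d : nat) (X : 'I_N -> set 'rV[R]_d)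
    (l : R) (j : 'I_N) (F : profile R N d -> 'rV[R]_d) : Prop :=
  forall (x : profile R N d) (y : 'rV[R]_d), joint X x -> X j y ->
    enorm (F (upd x j y) - F x) <= l * enorm (y - x j).

Definition action_sets (R : realType) (N d : nat) (rad D : R)
    (X : 'I_N -> set 'rV[R]_d) : Prop :=
  forall i, [/\ closed (X i), convex_set (X i),
    forall y, enorm y <= rad -> X i y
    & forall y z, X i y -> X i z -> enorm (y - z) <= D].

Definition quasidominance_weights (R : realType) (N : nat) (mu : 'I_N -> R)
    (L : 'I_N -> 'I_N -> R) (r : 'I_N -> R) : Prop :=
  forall i, 0 < r i /\ \sum_(j < N | j != i) r j * L i j < r i * mu i.

Definition dominance_gap (R : realType) (N : nat) (mu : 'I_N -> R)
    (L : 'I_N -> 'I_N -> R) (r : 'I_N -> R) (i : 'I_N) : R :=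
  mu i - (r i)^-1 * \sum_(j < N | j != i) r j * L i j.

(* With n.+1 agents the seed [ord0] is itself one of the indices, so this is
   the minimum over all agents. *)
Definition min_gap (R : realType) (n : nat) (mu : 'I_n.+1 -> R)
    (L : 'I_n.+1 -> 'I_n.+1 -> R) (r : 'I_n.+1 -> R) : R :=
  \big[Num.min/dominance_gap mu L r ord0]_(i < n.+1) dominance_gap mu L r i.

Definition partially_asynchronous (N : nat) (S : 'I_N -> set nat) (B : nat) :
    Prop :=
  forall (i : 'I_N) (t : nat), (1 <= t)%N ->
    exists s, S i s /\ (t <= s < t + B)%N.

(* Time starts at 1; the value [x 0] of the sequence plays no role. *)
Definition async_run (R : realType) (N d : nat) (X : 'I_N -> set 'rV[R]_d)
    (grad : 'I_N -> profile R N d -> 'rV[R]_d) (S : 'I_N -> set nat) (eta : R)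
    (x : nat -> profile R N d) : Prop :=
  joint X (x 1%N) /\
  forall (t : nat) (i : 'I_N), (1 <= t)%N ->
    (S i t -> is_proj (X i) (x t i - eta *: grad i (x t)) (x t.+1 i)) /\
    (~ S i t -> x t.+1 i = x t i).

(* Main.v *)
(* Measure errors in the weighted maximum norm max_i |x_i - x*_i| / r_i. Strong
   convexity of C_i in x_i, the Lipschitz bounds and the variational inequality
   at x* give
     <grad_i C_i(x), x_i - x*_i>
       >= mu_i |x_i - x*_i|^2 - |x_i - x*_i| sum_(j != i) L_ij |x_j - x*_j|,
   so by quasidominance an update of agent i turns a bound M on all the squared
   weighted errors into the bound (1 - 2 eta eps) M + eta^2 K for agent i. The
   bound M itself persists once it is above the floor m = eta K / (2 eps), hence
   each window of B steps contracts the excess over m by 1 - 2 eta eps. About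
   T / B windows leave an excess of order B / T, while m is of order
   B ln(T/B) / T; if eta is too large for this argument, the diameter bound
   suffices. This gives the rate with B in place of B^3.
   The equilibrium exists and is unique because the best-response map contracts
   the same weighted norm. *)

Require Import Defs.
From HB Require Import structures.
From mathcomp Require Import all_boot all_order all_algebra.
From mathcomp Require Import all_classical all_reals all_analysis.
From mathcomp Require Import ring lra zify.
Import Order.TTheory GRing.Theory Num.Theory.
Import numFieldNormedType.Exports.

Local Open Scope classical_set_scope.
Local Open Scope ring_scope.

Set Implicit Arguments.
Unset Strict Implicit.
Unset Printing Implicit Defensive.

(** * Euclidean geometry *)

Section Euclidean.
Variables (R : realType) (d : nat).
Implicit Types (u v w : 'rV[R]_d) (a : R).

Lemma dotvC u v : dotv u v = dotv v u.
Proof. by apply: eq_bigr => k _; rewrite mulrC. Qed.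

Lemma dotvDl u v w : dotv (u + v) w = dotv u w + dotv v w.
Proof. by rewrite -big_split; apply: eq_bigr => k _; rewrite mxE mulrDl. Qed.

Lemma dotvZl a u v : dotv (a *: u) v = a * dotv u v.
Proof. by rewrite mulr_sumr; apply: eq_bigr => k _; rewrite mxE mulrA. Qed.

Lemma dotvNl u v : dotv (- u) v = - dotv u v.
Proof. by rewrite -scaleN1r dotvZl mulN1r. Qed.

Lemma dotvBl u v w : dotv (u - v) w = dotv u w - dotv v w.
Proof. by rewrite dotvDl dotvNl. Qed.

Lemma dotvDr u v w : dotv w (u + v) = dotv w u + dotv w v.
Proof. by rewrite dotvC dotvDl !(dotvC w). Qed.

Lemma dotvZr a u v : dotv u (a *: v) = a * dotv u v.
Proof. by rewrite dotvC dotvZl dotvC. Qed.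

Lemma dotvNr u v : dotv u (- v) = - dotv u v.
Proof. by rewrite dotvC dotvNl dotvC. Qed.

Lemma dotvBr u v w : dotv w (u - v) = dotv w u - dotv w v.
Proof. by rewrite dotvDr dotvNr. Qed.

Lemma dotv_ge0 u : 0 <= dotv u u.
Proof. by apply: sumr_ge0 => k _; rewrite -expr2 sqr_ge0. Qed.

Lemma enorm_ge0 u : 0 <= enorm u.
Proof. exact: sqrtr_ge0. Qed.

Lemma sqr_enorm u : enorm u ^+ 2 = dotv u u.
Proof. exact/sqr_sqrtr/dotv_ge0. Qed.

Lemma sqr_coord_le_dotv u k : u ord0 k ^+ 2 <= dotv u u.
Proof.
rewrite /dotv (bigD1 k)//= expr2 lerDl sumr_ge0// => l _.
by rewrite -expr2 sqr_ge0.
Qed.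

Lemma enorm_eq0P u : enorm u = 0 -> u = 0.
Proof.
move=> u0; apply/rowP => k; rewrite mxE; apply/eqP.
by rewrite -sqrf_eq0 eq_le sqr_ge0 andbT (le_trans (sqr_coord_le_dotv u k))//
  -sqr_enorm u0 expr0n.
Qed.

Lemma dot0v u : dotv 0 u = 0.
Proof. by rewrite -(scale0r 0) dotvZl mul0r. Qed.

Lemma enorm0 : enorm (0 : 'rV[R]_d) = 0.
Proof. by rewrite /enorm dot0v sqrtr0. Qed.

(** Cauchy-Schwarz: expand the nonnegative square of [enorm v *: u - enorm u *: v] and cancel the
    positive factor [enorm u * enorm v]. *)
Lemma dotv_le u v : dotv u v <= enorm u * enorm v.
Proof.
have [/enorm_eq0P->|u0] := eqVneq (enorm u) 0.
  by rewrite dot0v enorm0 mul0r.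
have [/enorm_eq0P->|v0] := eqVneq (enorm v) 0.
  by rewrite dotvC dot0v enorm0 mulr0.
have uv0 : 0 < enorm u * enorm v.
  by rewrite mulr_gt0 // lt_neqAle enorm_ge0 andbT eq_sym.
have := dotv_ge0 (enorm v *: u - enorm u *: v).
rewrite dotvBl !dotvBr !dotvZl !dotvZr -!sqr_enorm (dotvC v u) => h.
rewrite -subr_ge0 -(pmulr_rge0 _ uv0); nra.
Qed.

Lemma normr_dotv_le u v : `|dotv u v| <= enorm u * enorm v.
Proof.
rewrite ler_norml dotv_le andbT lerNl -dotvNl (le_trans (dotv_le _ _))//.
by rewrite /enorm dotvNl dotvNr opprK.
Qed.

Lemma enormZ a u : enorm (a *: u) = `|a| * enorm u.
Proof.
by rewrite /enorm dotvZl dotvZr mulrA -expr2 sqrtrM ?sqr_ge0// sqrtr_sqr.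
Qed.

Lemma enormN u : enorm (- u) = enorm u.
Proof. by rewrite -scaleN1r enormZ normrN1 mul1r. Qed.

Lemma enormB u v : enorm (u - v) = enorm (v - u).
Proof. by rewrite -opprB enormN. Qed.

Lemma sqr_enormD u v :
  enorm (u + v) ^+ 2 = enorm u ^+ 2 + 2 * dotv u v + enorm v ^+ 2.
Proof.
by rewrite !sqr_enorm dotvDl !dotvDr (dotvC v u); ring.
Qed.

Lemma sqr_enormB u v :
  enorm (u - v) ^+ 2 = enorm u ^+ 2 - 2 * dotv u v + enorm v ^+ 2.
Proof. by rewrite sqr_enormD dotvNr enormN mulrN. Qed.

Lemma ler_enormD u v : enorm (u + v) <= enorm u + enorm v.
Proof.
rewrite -(@ler_pXn2r _ 2)// ?nnegrE ?addr_ge0 ?enorm_ge0//.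
by rewrite sqr_enormD sqrrD; have := dotv_le u v; lra.
Qed.

Lemma ler_enorm_dist w u v : enorm (u - v) <= enorm (u - w) + enorm (w - v).
Proof. by rewrite -(subrKA w u (- v)) ler_enormD. Qed.

Lemma mx_norm_le_enorm u : `|u| <= enorm u.
Proof.
rewrite [leLHS]/Num.norm/= mx_normrE; apply/bigmax_leP; split.
  exact: enorm_ge0.
move=> [i k] _ /=; rewrite ord1 -(@ler_pXn2r _ 2)// ?nnegrE ?enorm_ge0//.
by rewrite sqr_enorm real_normK ?num_real// sqr_coord_le_dotv.
Qed.

(** Together with [mx_norm_le_enorm] this moves estimates between the Euclidean norm and the library
    topology. The factor is crude: the sum of squares is at most [d] times the squared sup norm, and
    [d <= d ^ 2]. *)
Lemma enorm_le_mx_norm u : enorm u <= d%:R * `|u|.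
Proof.
have -> : enorm u = Num.sqrt (\sum_(k < d) `|u ord0 k| ^+ 2).
  by congr Num.sqrt; apply: eq_bigr => k _; rewrite real_normK ?num_real.
rewrite -[leRHS]ger0_norm ?mulr_ge0// -sqrtr_sqr ler_wsqrtr//.
apply: (@le_trans _ _ (\sum_(k < d) `|u| ^+ 2)).
  apply: ler_sum => k _; rewrite lerXn2r// ?nnegrE//.
  rewrite [leRHS]/Num.norm/= mx_normrE.
  by apply/bigmax_geP; right; exists (ord0, k).
rewrite sumr_const card_ord -[leLHS]mulr_natl exprMn ler_wpM2r ?sqr_ge0//.
by rewrite expr2 -natrM ler_nat; case: d => // m; rewrite leq_pmulr.
Qed.

End Euclidean.

(** * Gradients and best responses *)

(** Passage to the limit in first-order expansions; taking [e / (k + 1)] also covers [k = 0]. *)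
Lemma ler_epsM (R : realFieldType) (a b k : R) : 0 <= k ->
  (forall e, 0 < e -> a <= b + e * k) -> a <= b.
Proof.
move=> k0 h; apply/ler_addgt0Pr => e e0.
have k1 : 0 < k + 1 by rewrite ltr_wpDl.
apply: le_trans (h (e / (k + 1)) (divr_gt0 e0 k1)) _.
by rewrite lerD2l mulrAC ler_pdivrMr// ler_pM2l// lerDl.
Qed.

Lemma convex_setP (R : realType) (d : nat) (K : set 'rV[R]_d) y z (t : R) :
  convex_set K -> K y -> K z -> 0 <= t <= 1 -> K (t *: y + (1 - t) *: z).
Proof.
move=> cK Ky Kz t01.
have := cK y z (Itv01 (andP t01).1 (andP t01).2).
by rewrite !inE => /(_ Ky Kz).
Qed.

Definition best_response (R : realType) (N d : nat) (X : 'I_N -> set 'rV[R]_d)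
    (C : 'I_N -> profile R N d -> R) (i : 'I_N) (x : profile R N d)
    (z : 'rV[R]_d) : Prop :=
  X i z /\ forall y, X i y -> C i (upd x i z) <= C i (upd x i y).

(** * Profiles and changes of single coordinates *)

Section Profiles.
Variables (R : realType) (N d : nat) (X : 'I_N -> set 'rV[R]_d).
Implicit Types x : profile R N d.

Lemma upd_eq x i y : upd x i y i = y.
Proof. by rewrite /upd /= eqxx. Qed.

Lemma upd_neq x i y j : j != i -> upd x i y j = x j.
Proof. by rewrite /upd /= => /negbTE->. Qed.

Lemma upd_id x i : upd x i (x i) = x.
Proof.
apply/funext => j; have [->|ji] := eqVneq j i; first by rewrite upd_eq.
by rewrite upd_neq.
Qed.

Lemma upd_upd x i y z : upd (upd x i y) i z = upd x i z.
Proof.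
apply/funext => j; have [->|ji] := eqVneq j i; first by rewrite !upd_eq.
by rewrite !upd_neq.
Qed.

Lemma joint_upd x i y : joint X x -> X i y -> joint X (upd x i y).
Proof.
move=> Xx Xy j; have [->|ji] := eqVneq j i; first by rewrite upd_eq.
by rewrite upd_neq.
Qed.

Lemma nashP (C : 'I_N -> profile R N d -> R) x :
  nash X C x <-> joint X x /\ forall i, best_response X C i x (x i).
Proof.
split=> [[Xx h]|[Xx h]]; split=> // i.
  by split=> // y Xy; rewrite upd_id; exact: h.
by move=> y Xy; have [_ /(_ _ Xy)] := h i; rewrite upd_id.
Qed.

(** Pass from [y] to [x] one coordinate at a time through the hybrid profiles [z s]; the triangle
    inequality adds up the one-coordinate bounds. *)
Lemma lipschitz_joint (l : 'I_N -> R) (F : profile R N d -> 'rV[R]_d) x y :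
  (forall j, lipschitz_in X (l j) j F) -> joint X x -> joint X y ->
  enorm (F x - F y) <= \sum_j l j * enorm (x j - y j).
Proof.
move=> lipF Xx Xy.
pose z (s : seq 'I_N) : profile R N d := fun j => if j \in s then x j else y j.
have Xz s : joint X (z s) by move=> j; rewrite /z; case: ifP.
suff main s : uniq s ->
    enorm (F (z s) - F y) <= \sum_(j <- s) l j * enorm (x j - y j).
  have zx : z (index_enum 'I_N) = x.
    by apply/funext => j; rewrite /z mem_index_enum.
  by have := main _ (index_enum_uniq _); rewrite zx.
elim: s => [_|j s IHs /= /andP[js us]].
  have -> : z [::] = y by apply/funext => j; rewrite /z.
  by rewrite subrr enorm0 big_nil.
have -> : z (j :: s) = upd (z s) j (x j).
  apply/funext => k; rewrite /z inE; have [->|kj] := eqVneq k j.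
    by rewrite upd_eq.
  by rewrite upd_neq.
rewrite big_cons (le_trans (ler_enorm_dist (F (z s)) _ _))// lerD ?IHs//.
by have := lipF j (z s) (x j) (Xz s) (Xx j); rewrite {3}/z (negbTE js).
Qed.

End Profiles.

Section Game.
Variables (R : realType) (N d : nat) (X : 'I_N -> set 'rV[R]_d).
Variables (C : 'I_N -> profile R N d -> R).
Variables (grad : 'I_N -> profile R N d -> 'rV[R]_d).
Variables (mu : 'I_N -> R) (L : 'I_N -> 'I_N -> R).
Hypothesis mu_gt0 : forall i, 0 < mu i.
Hypothesis L_ge0 : forall i j, 0 <= L i j.
Hypothesis cvxX : forall i, convex_set (X i).
Hypothesis gradP : forall i x, joint X x -> is_pgradient X C i x (grad i x).
Hypothesis scC : forall i x, joint X x ->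
  strongly_convex_on (X i) (mu i) (fun y => C i (upd x i y)).
Hypothesis lipg : forall i j, lipschitz_in X (L i j) j (grad i).
Implicit Types x : profile R N d.

(** Convexity keeps the segment from [x i] to [w] in [X i], so the differential applies at a point
    of it near [x i]. The bound [t <= e] serves to absorb second-order terms into the error. *)
Lemma pgradient_segment i x w e : joint X x -> X i w -> 0 < e ->
  exists t, [/\ 0 < t, t <= 1, t <= e &
    `|C i (upd x i (t *: w + (1 - t) *: x i)) - C i x
      - t * dotv (grad i x) (w - x i)| <= t * (e * enorm (w - x i))].
Proof.
move=> Xx Xw e0; have := @gradP i x Xx _ e0 => /nbhs_ballP[s /= s0 sP].
set b := `|w - x i|.
have b1 : 0 < b + 1 by rewrite /b ltr_wpDl.
(* The last bound puts the point at distance [t * b < s] from [x i]; [b + 1] is positive even if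
   [w = x i]. *)
pose t := Num.min (Num.min 1 e) (s / (b + 1)).
have t0 : 0 < t by rewrite !lt_min ltr01 e0 divr_gt0.
have t1 : t <= 1 by rewrite !ge_min lexx.
have te : t <= e by rewrite !ge_min lexx orbT.
have ts : t * (b + 1) <= s by rewrite -ler_pdivlMr// !ge_min lexx !orbT.
exists t; split=> //.
have yE : t *: w + (1 - t) *: x i = x i + t *: (w - x i).
  by rewrite scalerBl scale1r scalerBr addrC -addrA (addrC (- _)).
have Xy : X i (t *: w + (1 - t) *: x i).
  by apply: convex_setP => //; rewrite t1 ltW.
have := sP (t *: w + (1 - t) *: x i).
rewrite -ball_normE /= => /(_ _ Xy).
rewrite {1 3 4}yE opprD addNKr normrN normrZ (gtr0_norm t0).
rewrite (addrC (x i)) addrK dotvZr enormZ (gtr0_norm t0) mulrCA; apply.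
by rewrite (lt_le_trans _ ts)// -/b ltr_pM2l// ltrDl.
Qed.

(** Strong convexity between [w] and [x i] is compared with the expansion at parameter [t] and
    divided by [t]. The remainders, [e * n] from the differential and [t * (mu i / 2 * n ^+ 2)] from
    the factor [1 - t], vanish with [e]. *)
Lemma strong_convexity_gradient i x w : joint X x -> X i w ->
  C i x + dotv (grad i x) (w - x i) + mu i / 2 * enorm (w - x i) ^+ 2
    <= C i (upd x i w).
Proof.
move=> Xx Xw; set n := enorm _; set g := dotv _ _.
have n0 : 0 <= n := enorm_ge0 _.
apply: (@ler_epsM _ _ _ (n + mu i / 2 * n ^+ 2)).
  by rewrite addr_ge0// mulr_ge0 ?sqr_ge0// divr_ge0// ltW.
move=> e e0; have [t [t0 t1 te]] := pgradient_segment Xx Xw e0.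
have t01 : 0 <= t <= 1 by rewrite t1 ltW.
have := @scC i x Xx _ _ _ Xw (Xx i) t01; rewrite upd_id -/n -/g.
set y := C i (upd x i (_ + _)); set cw := C i (upd x i w) => h1.
rewrite ler_norml => /andP[h2 _].
rewrite -(ler_pM2l t0).
have h3 : 0 <= t * (e - t) * (mu i / 2 * n ^+ 2).
  by rewrite !mulr_ge0 ?subr_ge0 ?sqr_ge0 ?invr_ge0// ltW.
nra.
Qed.

(** Sum of the previous inequality taken from [x i] to [w] and from [w] to [x i]. *)
Lemma gradient_strongly_monotone i x w : joint X x -> X i w ->
  mu i * enorm (x i - w) ^+ 2
    <= dotv (grad i x - grad i (upd x i w)) (x i - w).
Proof.
move=> Xx Xw.
have h1 := strong_convexity_gradient Xx Xw.
have := strong_convexity_gradient (joint_upd Xx Xw) (Xx i).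
rewrite upd_upd upd_id upd_eq (enormB w) in h1 *.
by rewrite -(opprB (x i) w) dotvNr in h1; rewrite dotvBl => h2; lra.
Qed.

(** A short move from the minimizer [z] towards [w] cannot lower the cost, so the first-order term
    is nonnegative up to [e]. *)
Lemma best_response_variational i x z w : joint X x ->
  best_response X C i x z -> X i w ->
  0 <= dotv (grad i (upd x i z)) (w - z).
Proof.
move=> Xx [Xz zmin] Xw; apply: (@ler_epsM _ _ _ (enorm (w - z))).
  exact: enorm_ge0.
move=> e e0; have Xu := joint_upd Xx Xz.
have [t [t0 t1 te]] := pgradient_segment Xu Xw e0.
rewrite upd_upd upd_eq ler_norml => /andP[_ h].
have := zmin (t *: w + (1 - t) *: z).
have Xy : X i (t *: w + (1 - t) *: z) by apply: convex_setP; rewrite // t1 ltW.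
move=> /(_ Xy) h2; rewrite -(pmulr_rge0 _ t0); lra.
Qed.

(** The gradient at [x] is reached from the one at [upd y i w] through [upd x i w]: the variational
    inequality holds at the start, the first change is Lipschitz in the other coordinates, the
    second is strongly monotone. Keeping [y] general serves both the algorithm ([y] an equilibrium,
    [w = y i]) and the comparison of best responses. *)
Lemma gradient_best_response i x (y : profile R N d) w :
  joint X x -> joint X y ->
  best_response X C i y w ->
  mu i * enorm (x i - w) ^+ 2
    - (\sum_(j | j != i) L i j * enorm (x j - y j)) * enorm (x i - w)
    <= dotv (grad i x) (x i - w).
Proof.
move=> Xx Xy bw; have Xw := bw.1.
have h1 := gradient_strongly_monotone Xx Xw.
have h3 := best_response_variational Xy bw (Xx i).
(* Both profiles have [w] in coordinate [i], so the term with [L i i] vanishes. *)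
have := lipschitz_joint (lipg i) (joint_upd Xx Xw) (joint_upd Xy Xw).
rewrite (bigD1 i)//= !upd_eq subrr enorm0 mulr0 add0r.
under eq_bigr => j ji do rewrite !upd_neq//.
set s := \sum_(j | _) _ => h4.
have := normr_dotv_le (grad i (upd x i w) - grad i (upd y i w)) (x i - w).
rewrite ler_norml => /andP[h5 _].
have := ler_wpM2r (enorm_ge0 (x i - w)) h4.
by move: h1 h5; rewrite !dotvBl; lra.
Qed.

(** Put [z] in coordinate [i] of [x] in the previous lemma: optimality of [z] makes the right side
    nonpositive, and a factor [enorm (z - w)] cancels. *)
Lemma best_response_lipschitz i x (y : profile R N d) z w :
  joint X x -> joint X y ->
  best_response X C i x z -> best_response X C i y w ->
  mu i * enorm (z - w) <= \sum_(j | j != i) L i j * enorm (x j - y j).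
Proof.
move=> Xx Xy bz bw.
have h1 := gradient_best_response (joint_upd Xx bz.1) Xy bw.
have := best_response_variational Xx bz bw.1.
rewrite -(opprB z) dotvNr oppr_ge0 upd_eq in h1 * => h2.
move: h1; under eq_bigr => j ji do rewrite upd_neq//.
set s := \sum_(j | _) _; have [->|n0] := eqVneq (enorm (z - w)) 0.
  by move=> _; rewrite mulr0 sumr_ge0// => j _; rewrite mulr_ge0 ?enorm_ge0.
have {}n0 : 0 < enorm (z - w) by rewrite lt_neqAle eq_sym n0 enorm_ge0.
by move=> h1; rewrite -(ler_pM2r n0); lra.
Qed.

(** A minimum exists by compactness; continuity relative to [X i] follows from the differential. *)
Lemma best_response_exists i x : closed (X i) -> X i !=set0 ->
  (exists D, forall y z : 'rV[R]_d, X i y -> X i z -> enorm (y - z) <= D) ->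
  joint X x -> exists z, best_response X C i x z.
Proof.
move=> clX [y0 Xy0] [D DX] Xx.
have cX : compact (X i).
  apply: bounded_closed_compact => //; exists (D + enorm y0).
  split; first exact: num_real.
  move=> M DM y Xy.
  apply/(le_trans (mx_norm_le_enorm _))/ltW/(le_lt_trans _ DM).
  by rewrite -[y](subrK y0) (le_trans (ler_enormD _ _))// lerD2r DX.
have fX : {within X i, continuous (fun y => C i (upd x i y))}.
  apply/subspace_continuousP => z Xz; apply/cvgrPdist_le => e e0.
  rewrite near_withinE; have Xu := joint_upd Xx Xz.
  have := @gradP i _ Xu _ (ltr01 : 0 < 1 :> R); rewrite upd_eq.
  set g := grad i _.
  (* The expansion with error constant 1 bounds the slope near [z] by [enorm g + 1]; the factor
     [d%:R] converts to the sup norm. *)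
  pose K := (enorm g + 1) * d%:R.
  have K1 : 0 < K + 1.
    by rewrite ltr_wpDl// mulr_ge0// addr_ge0// enorm_ge0.
  have nz : \forall y \near z, `|z - y| <= e / (K + 1).
    apply/nbhs_ballP; exists (e / (K + 1)); first by rewrite /= divr_gt0.
    by move=> y; rewrite -ball_normE => /ltW.
  move=> h; near=> y => Xy.
  have yz : `|z - y| <= e / (K + 1) by near: y.
  have : `|C i (upd x i y) - C i (upd x i z) - dotv g (y - z)|
      <= 1 * enorm (y - z).
    by have := near h y; rewrite upd_upd; apply.
  have := normr_dotv_le g (y - z).
  have nK : (enorm g + 1) * enorm (y - z) <= e.
    apply: (@le_trans _ _ (K * (e / (K + 1)))).
      rewrite /K -mulrA ler_wpM2l// ?addr_ge0 ?enorm_ge0//.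
      by rewrite (le_trans (enorm_le_mx_norm _))// ler_wpM2l// distrC.
    by rewrite mulrCA ler_piMr ?(ltW e0)// ler_pdivrMr// mul1r lerDl.
  rewrite !ler_norml => /andP[h1 h2] /andP[h3 h4].
  move: nK; rewrite mulrDl mul1r => nK.
  by rewrite /from_subspace; apply/andP; split; lra.
have [z + zP] := compact_EVT_min (ex_intro _ _ Xy0) cX fX.
by rewrite inE => Xz; exists z; split=> // y Xy; apply: zP; rewrite inE.
Unshelve. all: by end_near. Qed.

End Game.

(** * Convergence *)

(** Minimality of [p] along the segment towards [w] gives the obtuse angle at [p]; expanding the
    square of [(p - w) - (p - y)] then yields the bound. *)
Lemma proj_nonexpansive (R : realType) (d : nat) (K : set 'rV[R]_d) y p w :
  convex_set K -> is_proj K y p -> K w -> enorm (p - w) <= enorm (y - w).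
Proof.
move=> cK [Kp pmin] Kw.
have obtuse : 0 <= dotv (p - y) (w - p).
  apply: (@ler_epsM _ _ _ (enorm (w - p) ^+ 2)); first exact: sqr_ge0.
  move=> e e0; pose t := Num.min 1 e.
  have t0 : 0 < t by rewrite lt_min ltr01.
  have t1 : t <= 1 by rewrite ge_min lexx.
  have te : t <= e by rewrite ge_min lexx orbT.
  have Kz : K (t *: w + (1 - t) *: p) by apply: convex_setP; rewrite // t1 ltW.
  have := pmin _ Kz; rewrite -(@ler_pXn2r _ 2)// ?nnegrE ?enorm_ge0//.
  have -> : t *: w + (1 - t) *: p - y = (p - y) + t *: (w - p).
    apply/rowP => k; rewrite !mxE; ring.
  rewrite (sqr_enormD (p - y)) enormZ dotvZr exprMn gtr0_norm//.
  rewrite -(pmulr_rge0 _ t0) => h.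
  have : 0 <= t * (e - t) * enorm (w - p) ^+ 2.
    by apply: mulr_ge0 (sqr_ge0 _); apply: mulr_ge0; lra.
  have : 0 <= t * e * enorm (w - p) ^+ 2.
    by apply: mulr_ge0 (sqr_ge0 _); apply: mulr_ge0; lra.
  by lra.
rewrite -(@ler_pXn2r _ 2)// ?nnegrE ?enorm_ge0//.
have -> : y - w = (p - w) - (p - y) by apply/rowP => k; rewrite !mxE; ring.
move: obtuse; rewrite -(opprB p w) dotvNr.
rewrite (sqr_enormB (p - w)) (dotvC (p - w)).
by have := sqr_ge0 (enorm (p - y)); lra.
Qed.

(** The full windows between times 1 and [T] miss fewer than [B] of the [T - 1] steps, so they cover
    at least [T - B], which is at least half of [T]. *)
Lemma half_le_trunc_div (B T : nat) : (1 <= B)%N -> (2 * B <= T)%N ->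
  (T <= 2 * (T.-1 %/ B * B))%N.
Proof.
move=> B1 BT; have := divn_eq T.-1 B; have := ltn_pmod T.-1 B1.
by move: (T.-1 %/ B * B)%N (T.-1 %% B)%N => p q; lia.
Qed.

(* [m] is the error floor: each update contracts the excess over [m] of the
   largest error, and a window of [B] steps gives every agent an update. *)
Lemma async_contraction (R : realType) (N : nat) (S : 'I_N -> set nat)
    (B : nat) (v : nat -> 'I_N -> R) (rho m M0 : R) :
  0 <= rho <= 1 -> m <= M0 -> partially_asynchronous S B ->
  (forall t i M, (1 <= t)%N -> m <= M -> (forall j, v t j <= M) -> S i t ->
    v t.+1 i <= m + rho * (M - m)) ->
  (forall t i, (1 <= t)%N -> ~ S i t -> v t.+1 i = v t i) ->
  (forall j, v 1 j <= M0) ->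
  forall k t j, (1 + k * B <= t)%N -> v t j <= m + rho ^+ k * (M0 - m).
Proof.
move=> /andP[rho0 rho1] mM0 SB step stay v1.
have step_le M : m <= M -> m + rho * (M - m) <= M.
  move=> mM; have : 0 <= (1 - rho) * (M - m) by rewrite mulr_ge0 ?subr_ge0.
  by lra.
(* Any common bound above the floor persists: updates preserve it and idle agents keep their
   values. *)
have inv t0 M : (1 <= t0)%N -> m <= M -> (forall j, v t0 j <= M) ->
    forall t j, (t0 <= t)%N -> v t j <= M.
  move=> t01 mM vt0; elim=> [j|t IHt j].
    by rewrite leqn0 => /eqP t00; move: t01; rewrite t00.
  rewrite leq_eqVlt => /orP[/eqP<-//|]; rewrite ltnS => t0t.
  have t1 := leq_trans t01 t0t.
  have [Sjt|nSjt] := pselect (S j t); last by rewrite stay// IHt.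
  by apply: le_trans (step_le _ mM); apply: step => // i; exact: IHt.
have geM k : m <= m + rho ^+ k * (M0 - m).
  by rewrite lerDl mulr_ge0 ?exprn_ge0 ?subr_ge0.
elim=> [t j|k IHk t j].
  by rewrite expr0 mul1r addrC subrK mul0n addn0; exact: inv.
rewrite mulSn addnCA => tkB.
set M := m + rho ^+ k * (M0 - m).
have {}IHk t' i : (1 + k * B <= t')%N -> v t' i <= M by exact: IHk.
have -> : m + rho ^+ k.+1 * (M0 - m) = m + rho * (M - m).
  by rewrite exprS /M; ring.
have [|s [Sjs /andP[kBs sB]]] := SB j (1 + k * B)%N; first by rewrite leq_addr.
have : (s < t)%N by rewrite (leq_trans sB)// addnC.
(* From the update time [s] on, each update of [j] gives the new bound directly from [M], and idle
   steps preserve it; an idle step at [t = s] is impossible. *)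
elim: t {tkB} => // t IHt; rewrite ltnS => st.
have kBt := leq_trans kBs st; have t1 : (1 <= t)%N by apply: leq_trans kBt.
have [Sjt|nSjt] := pselect (S j t).
  by apply: step => //; [exact: geM | move=> i; exact: IHk].
rewrite stay//; move: st; rewrite leq_eqVlt => /orP[/eqP st|]; last exact: IHt.
by rewrite st in Sjs.
Qed.

(** Joins completeness with the norm on matrices, so that [normed_cvg] applies to the best-response
    iterates. *)
HB.instance Definition _ (R : realType) (m n : nat) :=
  Complete.on 'M[R]_(m, n).

(** * Contraction in the weighted maximum norm: equilibrium and rate *)

Section Quasidominance.
Variables (R : realType) (N d : nat) (X : 'I_N -> set 'rV[R]_d).
Variables (C : 'I_N -> profile R N d -> R).
Variables (grad : 'I_N -> profile R N d -> 'rV[R]_d).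
Variables (mu : 'I_N -> R) (L : 'I_N -> 'I_N -> R) (r : 'I_N -> R) (eps : R).
Variables (rad D : R).
Hypothesis mu_gt0 : forall i, 0 < mu i.
Hypothesis L_ge0 : forall i j, 0 <= L i j.
Hypothesis r_gt0 : forall i, 0 < r i.
Hypothesis eps_gt0 : 0 < eps.
Hypothesis gap : forall i,
  \sum_(j | j != i) r j * L i j <= r i * (mu i - eps).
Hypothesis rad_gt0 : 0 < rad.
Hypothesis setsX : action_sets rad D X.
Hypothesis gradP : forall i x, joint X x -> is_pgradient X C i x (grad i x).
Hypothesis scC : forall i x, joint X x ->
  strongly_convex_on (X i) (mu i) (fun y => C i (upd x i y)).
Hypothesis lipg : forall i j, lipschitz_in X (L i j) j (grad i).
Implicit Types x : profile R N d.

Let cvxX i : convex_set (X i). Proof. by case: (setsX i). Qed.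

Lemma gap_le_mu i : eps <= mu i.
Proof.
rewrite -subr_ge0 -(pmulr_rge0 _ (r_gt0 i)) (le_trans _ (gap i))// sumr_ge0//.
by move=> j _; rewrite mulr_ge0// ltW.
Qed.

(** The point where quasidominance enters: errors measured with weights [r] interact through at most
    [mu i - eps]. *)
Lemma weighted_sum_le i (a : 'I_N -> R) M : 0 <= M ->
  (forall j, a j <= r j * M) ->
  \sum_(j | j != i) L i j * a j <= r i * (mu i - eps) * M.
Proof.
move=> M0 aM; apply: le_trans (ler_wpM2r M0 (gap i)).
rewrite mulr_suml; apply: ler_sum => j _.
by rewrite (mulrC (r j)) -mulrA ler_wpM2l.
Qed.

(** Common contraction factor: the denominator dominates every [mu i], hence
    [1 - eps / mu i <= q]. *)
Let q := 1 - eps / (eps + \sum_i mu i).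

Let den_gt0 : 0 < eps + \sum_i mu i.
Proof. by rewrite ltr_pwDl// sumr_ge0// => i _; rewrite ltW. Qed.

Let q_lt1 : q < 1.
Proof. by rewrite /q gtrBl divr_gt0. Qed.

Let q_ge0 : 0 <= q.
Proof.
rewrite /q subr_ge0 ler_pdivrMr// mul1r lerDl sumr_ge0// => i _.
by rewrite ltW.
Qed.

Let best_response_contraction i x (y : profile R N d) z w M : 0 <= M ->
  joint X x -> joint X y ->
  best_response X C i x z -> best_response X C i y w ->
  (forall j, enorm (x j - y j) <= r j * M) -> enorm (z - w) <= r i * (q * M).
Proof.
move=> M0 Xx Xy bz bw xyM; rewrite -(ler_pM2l (mu_gt0 i)).
have := best_response_lipschitz mu_gt0 L_ge0 cvxX gradP scC lipg Xx Xy bz bw.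
move/le_trans; apply; apply: le_trans (weighted_sum_le i M0 xyM) _.
rewrite (mulrCA (mu i)) -mulrA ler_pM2l// mulrA ler_wpM2r// /q mulrBr mulr1.
rewrite lerD2l lerN2 mulrCA ler_piMr ?(ltW eps_gt0)// ler_pdivrMr// mul1r.
rewrite (bigD1 i)//= ler_wpDl ?(ltW eps_gt0)// lerDl sumr_ge0// => j _.
by rewrite ltW.
Qed.

Lemma nash_unique x (y : profile R N d) : nash X C x -> nash X C y -> x = y.
Proof.
move=> /nashP[Xx bx] /nashP[Xy by_].
pose M := \big[Num.max/0]_i (enorm (x i - y i) / r i).
have M0 : 0 <= M by exact: bigmax_ge_id.
have xyM j : enorm (x j - y j) <= r j * M.
  by rewrite mulrC -ler_pdivrMr// /M le_bigmax.
have MqM : M <= q * M.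
  apply/bigmax_leP; split=> [|i _]; first by rewrite mulr_ge0.
  rewrite ler_pdivrMr// mulrC.
  exact: (best_response_contraction M0 Xx Xy (bx i) (by_ i) xyM).
have {}M0 : M <= 0.
  by rewrite -(pmulr_rle0 _ (_ : 0 < 1 - q)) ?subr_gt0// mulrBl mul1r subr_le0.
apply/funext => j; apply/eqP; rewrite -subr_eq0; apply/eqP/enorm_eq0P/eqP.
by rewrite eq_le enorm_ge0 andbT (le_trans (xyM j))// pmulr_rle0.
Qed.

(** Picard iteration of the best-response map from the origin: increments decay geometrically, and
    the limit is a fixed point. *)
Lemma nash_exists : exists x, nash X C x.
Proof.
have X0 i : X i 0 by have [_ _ + _] := setsX i; apply; rewrite enorm0 ltW.
have brx (ix : 'I_N * profile R N d) : exists z,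
    joint X ix.2 -> best_response X C ix.1 ix.2 z.
  (* Outside [joint X] the value 0 is a default that makes the choice function total. *)
  have [Xx|nXx] := pselect (joint X ix.2); last by exists 0.
  have [clX _ _ DX] := setsX ix.1.
  have X0' : X ix.1 !=set0 by exists 0.
  have [z bz] := best_response_exists gradP clX X0' (ex_intro _ _ DX) Xx.
  by exists z.
have [br brP] := choice brx.
pose F x : profile R N d := fun i => br (i, x).
have FP i x : joint X x -> best_response X C i x (F x i) := brP (i, x).
pose xs k := iter k F (fun=> 0).
have Xs k : joint X (xs k).
  elim: k => [|k IHk] i; first exact: X0.
  exact: (FP i _ IHk).1.
pose M := \big[Num.max/0]_i (D / r i).
have M0 : 0 <= M by exact: bigmax_ge_id.
have dxs k i : enorm (xs k.+1 i - xs k i) <= r i * (M * q ^+ k).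
  elim: k i => [|k IHk] i.
    rewrite mulr1; have [_ _ _ DX] := setsX i.
    apply: le_trans (DX _ _ (Xs _ i) (Xs _ i)) _.
    by rewrite mulrC -ler_pdivrMr// /M (le_bigmax _ (fun i => D / r i)).
  rewrite exprS (mulrCA M).
  apply: (best_response_contraction _ (Xs k.+1) (Xs k) (FP i _ (Xs k.+1))
    (FP i _ (Xs k)) IHk).
  by rewrite mulr_ge0// exprn_ge0.
have cxs i : cvgn (fun k => xs k i).
  have cs : cvgn (series (telescope (fun k => xs k i))).
    apply: normed_cvg.
    have q1 : `|q| < 1 by rewrite ger0_norm.
    apply: series_le_cvg (is_cvg_geometric_series (a := r i * M) q1) => k /=.
    - exact: normr_ge0.
    - by rewrite !mulr_ge0 ?exprn_ge0// ltW.
    - by rewrite (le_trans (mx_norm_le_enorm _))// -mulrA dxs.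
  have -> : (fun k => xs k i)
      = cst (xs 0%N i) \+ series (telescope (fun k => xs k i)).
    by apply/funext => k; exact: eq_sum_telescope.
  by apply: is_cvgD => //; exact: is_cvg_cst.
pose p : profile R N d := fun i => limn (fun k => xs k i).
have Xp : joint X p.
  move=> i; have [clX _ _ _] := setsX i.
  by apply: (closed_cvg _ clX _ _ (cxs i)); apply: nearW => k; exact: Xs.
have near_p e : 0 < e ->
    \forall k \near \oo, forall i, enorm (xs k i - p i) <= r i * e.
  move=> e0; apply: filter_forall => i.
  have d1 : 0 < d%:R + 1 :> R by rewrite ltr_wpDl.
  have := cxs i => /cvgrPdist_le /(_ (r i * e / (d%:R + 1))).
  rewrite divr_gt0 ?mulr_gt0// => /(_ isT); apply: filterS => k h.
  apply: le_trans (enorm_le_mx_norm _) _; rewrite distrC.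
  apply: le_trans (ler_wpM2l (ler0n _ _) h) _.
  have re0 : 0 <= r i * e by rewrite mulr_ge0 ?ltW.
  by rewrite mulrCA ler_piMr// ler_pdivrMr// mul1r lerDl.
(* By contraction [F p i] is within [r i * e] of [xs k.+1 i], which is within [r i * e] of [p i]. *)
have pF i : F p i = p i.
  apply/eqP; rewrite -subr_eq0; apply/eqP/enorm_eq0P/eqP.
  rewrite eq_le enorm_ge0 andbT.
  apply: (@ler_epsM _ _ _ (2 * r i)); first by rewrite mulr_ge0// ltW.
  move=> e e0; have [k _ hk] := near_p e e0.
  have h1 j : enorm (xs k j - p j) <= r j * e by exact: (hk k (leqnn k)).
  have h2 : enorm (xs k.+1 i - p i) <= r i * e by exact: (hk k.+1 (leqnSn k)).
  have e0' := ltW e0.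
  have h3 := best_response_contraction e0' (Xs k) Xp (FP i _ (Xs k))
    (FP i _ Xp) h1.
  rewrite (le_trans (ler_enorm_dist (xs k.+1 i) _ _))// (enormB (F p i)).
  have h4 : r i * (q * e) <= r i * e.
    by rewrite ler_pM2l// ler_piMl// ltW.
  by rewrite add0r; move: (le_trans h3 h4) h2; rewrite [xs k.+1 i]/=; lra.
exists p; apply/nashP; split=> // i; rewrite -pF; exact: FP.
Qed.

(** Nonexpansiveness reduces to the unprojected step, whose square is expanded. The condition
    [eta * mu i <= 1 / 2] keeps the coefficient [1 - 2 * (eta * mu i)] nonnegative, so that the
    agent's own error may be replaced by its bound. *)
Lemma update_error_le U eta i x xstar p M : 0 <= eta -> eta * mu i <= 1 / 2 ->
  joint X x -> nash X C xstar -> enorm (grad i x) <= U ->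
  is_proj (X i) (x i - eta *: grad i x) p ->
  0 <= M -> (forall j, enorm (x j - xstar j) ^+ 2 <= r j ^+ 2 * M) ->
  enorm (p - xstar i) ^+ 2
    <= r i ^+ 2 * ((1 - 2 * eta * eps) * M) + eta ^+ 2 * U ^+ 2.
Proof.
move=> eta0 etamu Xx /nashP[Xs bs] gU pp M0 xM.
have h1 := gradient_best_response mu_gt0 cvxX gradP scC lipg Xx Xs (bs i).
pose W := Num.sqrt M; have W0 : 0 <= W := sqrtr_ge0 _.
have WM : W ^+ 2 = M by exact: sqr_sqrtr.
have xW j : enorm (x j - xstar j) <= r j * W.
  rewrite -(@ler_pXn2r _ 2)// ?nnegrE ?enorm_ge0 ?mulr_ge0 ?(ltW (r_gt0 j))//.
  by rewrite exprMn WM.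
have h2 := weighted_sum_le i W0 xW.
have h3 := proj_nonexpansive (@cvxX i) pp (Xs i).
have e0 := enorm_ge0 (x i - xstar i).
rewrite -(@ler_pXn2r _ 2) ?nnegrE ?enorm_ge0// in h3.
apply: (le_trans h3).
have -> : x i - eta *: grad i x - xstar i
    = (x i - xstar i) - eta *: grad i x by rewrite addrAC.
rewrite sqr_enormB enormZ exprMn real_normK ?num_real// dotvZr.
rewrite (dotvC (x i - xstar i)).
apply: lerD; last first.
  rewrite ler_wpM2l ?sqr_ge0// lerXn2r// ?nnegrE ?enorm_ge0//.
  exact: le_trans (enorm_ge0 _) gU.
move: h1 h2 (xW i) e0; set b := enorm (x i - _); set g := dotv _ _.
set s := \sum_(j | _) _ => h1 h2 bW b0.
have gm := gap_le_mu i; have ri := r_gt0 i.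
have {}h1 : mu i * b ^+ 2 - (r i * (mu i - eps) * W) * b <= g.
  by apply: le_trans h1; rewrite lerD2l lerN2 ler_wpM2r.
have h4 : b ^+ 2 <= (r i * W) ^+ 2 by rewrite lerXn2r// nnegrE mulr_ge0// ltW.
have h5 : b * (r i * W) <= (r i * W) ^+ 2.
  by rewrite expr2 ler_wpM2r// mulr_ge0// ltW.
have h6 := ler_wpM2l eta0 h1.
have k1 : 0 <= 1 - 2 * (eta * mu i) by lra.
have k2 : 0 <= 2 * eta * (mu i - eps) by apply: mulr_ge0; lra.
have h7 := ler_wpM2l k1 h4; have h8 := ler_wpM2l k2 h5.
move: h6 h7 h8; rewrite -WM => h6 h7 h8.
have -> : r i ^+ 2 * ((1 - 2 * eta * eps) * W ^+ 2)
  = (1 - 2 * (eta * mu i)) * (r i * W) ^+ 2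
    + 2 * eta * (mu i - eps) * (r i * W) ^+ 2 by ring.
apply: le_trans (lerD h7 h8).
by lra.
Qed.

Let A := \sum_j D ^+ 2 / r j ^+ 2.

(** The first product covers small steps, with one term for the floor and one for the remaining
    excess; the last summand covers large steps. Sums over agents stand in for maxima. *)
Definition rate_constant (U : R) : R :=
  (\sum_j r j ^+ 2) * ((\sum_j U ^+ 2 / r j ^+ 2) / (2 * eps ^+ 2)
    + (\sum_j D ^+ 2 / r j ^+ 2) / ln 2)
  + D ^+ 2 * (2 * (\sum_j mu j) / eps).

Lemma async_run_rate U B T (S : 'I_N -> set nat) (x : nat -> profile R N d)
    xstar i :
  (forall i x, joint X x -> enorm (grad i x) <= U) ->
  nash X C xstar -> (1 <= B)%N -> (2 * B <= T)%N ->
  partially_asynchronous S B ->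
  async_run X grad S (B%:R * ln (T%:R / B%:R) / (eps * T%:R)) x ->
  enorm (x T i - xstar i) ^+ 2
    <= rate_constant U * (B%:R * ln (T%:R / B%:R) / T%:R).
Proof.
move=> gU ns B1 BT SB [X1 run].
have B0 : 0 < B%:R :> R by rewrite ltr0n.
have T0 : 0 < T%:R :> R by rewrite ltr0n (leq_trans _ BT)// muln_gt0.
have BT' : 2 * B%:R <= T%:R :> R by rewrite -natrM ler_nat.
have TB2 : 2 <= T%:R / B%:R :> R by rewrite ler_pdivlMr.
have ln2 : 0 < ln 2 :> R by rewrite ln_gt0// ltr1n.
have lnTB : ln 2 <= ln (T%:R / B%:R) :> R.
  by rewrite ler_ln ?posrE// (lt_le_trans _ TB2).
set l := B%:R * _ / _; have l0 : 0 < l.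
  by rewrite divr_gt0// mulr_gt0// (lt_le_trans ln2).
have etaE : B%:R * ln (T%:R / B%:R) / (eps * T%:R) = l / eps.
  by rewrite /l invfM mulrA mulrAC.
rewrite etaE in run; set eta := l / eps in run.
have eps_neq0 : eps != 0 by rewrite gt_eqF.
have eta0 : 0 < eta by rewrite divr_gt0.
have r2_gt0 j : 0 < r j ^+ 2 by rewrite exprn_gt0.
have K0 : 0 <= \sum_j U ^+ 2 / r j ^+ 2.
  by apply: sumr_ge0 => j _; rewrite divr_ge0 ?sqr_ge0.
have A0 : 0 <= A by apply: sumr_ge0 => j _; rewrite divr_ge0 ?sqr_ge0.
have Sr0 : 0 <= \sum_j r j ^+ 2 by apply: sumr_ge0 => j _; rewrite sqr_ge0.
have Smu0 : 0 <= \sum_j mu j by apply: sumr_ge0 => j _; rewrite ltW.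
rewrite /rate_constant -/A; set K := \sum_j U ^+ 2 / _ in K0 *.
set c1 := _ * (_ + _); set c2 := _ * (_ / eps).
have c1_ge0 : 0 <= c1.
  rewrite mulr_ge0// addr_ge0// divr_ge0//; last exact: ltW.
  by rewrite mulr_ge0// sqr_ge0.
have c2_ge0 : 0 <= c2.
  by rewrite mulr_ge0 ?sqr_ge0// divr_ge0 ?(ltW eps_gt0)// mulr_ge0.
have Xx t : (1 <= t)%N -> joint X (x t).
  case: t => // t _; elim: t => // t IHt j.
  have [upd_t stay_t] := run t.+1 j isT.
  have [Sjt|nSjt] := pselect (S j t.+1); first exact: (upd_t Sjt).1.
  by rewrite stay_t.
have Xs := ns.1.
have T1 : (1 <= T)%N by rewrite -(ltr0n R).
have xD t j : (1 <= t)%N -> enorm (x t j - xstar j) ^+ 2 <= D ^+ 2.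
  move=> t1; have [_ _ _ DX] := setsX j.
  have h := DX _ _ (Xx t t1 j) (Xs j).
  by rewrite lerXn2r// nnegrE ?enorm_ge0// (le_trans (enorm_ge0 _) h).
(* If some [eta * mu j] exceeds 1/2, then [2 * (\sum_j mu j) / eps * l] exceeds 1 and the diameter
   bound is enough. *)
have [/forallP small|] := boolP [forall j, eta * mu j <= 1 / 2]; last first.
  move=> /forallPn[j]; rewrite -ltNge => large.
  apply: (le_trans (xD T i T1)); rewrite mulrDl.
  apply: (@le_trans _ _ (c2 * l)); last by rewrite lerDr mulr_ge0// ltW.
  rewrite /c2 -mulrA ler_peMr ?sqr_ge0// mulrAC -mulrA -/eta.
  have mu_le : mu j <= \sum_j mu j.
    by rewrite (bigD1 j)//= lerDl sumr_ge0// => k _; rewrite ltW.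
  by have := ler_wpM2l (ltW eta0) mu_le; lra.
(* [m] is the fixed point of [M |-> rho * M + eta ^+ 2 * K]. *)
pose rho := 1 - 2 * l; pose m := eta * K / (2 * eps).
have rhoE : rho = 1 - 2 * eta * eps by rewrite /rho /eta; field.
have m0 : 0 <= m.
  by apply: divr_ge0; apply: mulr_ge0 => //; exact: ltW.
have rho01 : 0 <= rho <= 1.
  apply/andP; split; last by rewrite /rho; lra.
  have := ler_wpM2l (ltW eta0) (gap_le_mu i); have := small i.
  by rewrite rhoE; lra.
have r2_neq0 j : r j ^+ 2 != 0 by rewrite gt_eqF.
pose v t j := enorm (x t j - xstar j) ^+ 2 / r j ^+ 2.
have vE t j : enorm (x t j - xstar j) ^+ 2 = r j ^+ 2 * v t j.
  by rewrite /v mulrC divfK.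
have step t j M : (1 <= t)%N -> m <= M -> (forall k, v t k <= M) -> S j t ->
    v t.+1 j <= m + rho * (M - m).
  move=> t1 mM vM Sjt; have [/(_ Sjt) pj _] := run t j t1.
  have M0 := le_trans m0 mM.
  have vM' k : enorm (x t k - xstar k) ^+ 2 <= r k ^+ 2 * M.
    by rewrite vE ler_pM2l.
  have h := update_error_le (ltW eta0) (small j) (Xx t t1) ns
    (gU j _ (Xx t t1)) pj M0 vM'.
  rewrite /v ler_pdivrMr// (le_trans h)// -rhoE mulrC.
  have UK : U ^+ 2 <= r j ^+ 2 * K.
    rewrite mulrC -ler_pdivrMr// /K (bigD1 j)//= lerDl sumr_ge0// => k _.
    by rewrite divr_ge0 ?sqr_ge0.
  have -> : (m + rho * (M - m)) * r j ^+ 2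
      = rho * M * r j ^+ 2 + eta ^+ 2 * (r j ^+ 2 * K).
    by rewrite rhoE /m; field.
  by rewrite lerD2l ler_wpM2l ?sqr_ge0.
have stay t j : (1 <= t)%N -> ~ S j t -> v t.+1 j = v t j.
  by move=> t1 nSjt; have [_ /(_ nSjt)] := run t j t1; rewrite /v => ->.
have v1 j : v 1%N j <= m + A.
  rewrite ler_wpDl// /A (bigD1 j)//= ler_wpDr//.
    by apply: sumr_ge0 => k _; rewrite divr_ge0 ?sqr_ge0.
  by rewrite /v ler_wpM2r ?invr_ge0 ?sqr_ge0// xD.
have mA : m <= m + A by rewrite lerDl.
pose k := (T.-1 %/ B)%N.
have kT : (1 + k * B <= T)%N.
  by rewrite add1n -[leqRHS](prednK T1) ltnS leq_divM.
have := async_contraction rho01 mA SB step stay v1 i kT.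
rewrite [X in X - m]addrC addrK => vT.
(* Since [1 - 2 * l <= expR (- (2 * l))] and [2 * k * B >= T], the exponent is at most
   [- ln (T / B)]. *)
have rho_le : rho ^+ k <= B%:R / T%:R.
  have lnE : B%:R / T%:R = expR (- ln (T%:R / B%:R)) :> R.
    by rewrite expRN lnK ?invf_div// posrE divr_gt0.
  rewrite lnE; apply: (@le_trans _ _ (expR (- (2 * l)) ^+ k)).
    rewrite lerXn2r ?nnegrE ?expR_ge0//; first by case/andP: rho01.
    exact: expR_ge1Dx.
  rewrite -expRM_natl ler_expR mulrN lerN2 /l.
  have kB : (T <= 2 * (k * B))%N by apply: half_le_trunc_div.
  have : T%:R <= 2 * (k%:R * B%:R) :> R by rewrite -!natrM ler_nat.
  have -> : k%:R * (2 * (B%:R * ln (T%:R / B%:R) / T%:R))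
    = 2 * (k%:R * B%:R) / T%:R * ln (T%:R / B%:R) :> R by ring.
  move=> h; rewrite ler_peMl ?ler_pdivlMr ?mul1r// ltW//.
  exact: lt_le_trans lnTB.
have {}vT : v T i <= l * (K / (2 * eps ^+ 2) + A / ln 2).
  apply: (le_trans vT); rewrite mulrDr; apply: lerD.
    by rewrite /m /eta le_eqVlt; apply/orP; left; apply/eqP; field.
  (* The excess [A * B / T] is turned into a multiple of [l] by [ln 2 <= ln (T / B)]. *)
  apply: le_trans (ler_wpM2r A0 rho_le) _.
  rewrite mulrCA mulrC ler_wpM2l// ler_pdivlMr// /l mulrAC.
  by rewrite ler_wpM2r ?invr_ge0 ?(ltW T0)// ler_pM2l.
have ri : r i ^+ 2 <= \sum_j r j ^+ 2.
  by rewrite (bigD1 i)//= lerDl sumr_ge0// => j _; rewrite sqr_ge0.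
rewrite vE mulrDl (@le_trans _ _ (c1 * l))//; last first.
  by rewrite lerDl mulr_ge0// ltW.
rewrite /c1 -mulrA ler_pM// ?sqr_ge0//; last by rewrite mulrC.
by rewrite /v divr_ge0 ?sqr_ge0.
Qed.

End Quasidominance.

(** In positive dimension there is an admissible vector of norm [rad]; comparing [F] there and at
    the origin gives [0 <= l * rad]. *)
Lemma lipschitz_in_ge0 (R : realType) (N d : nat) (X : 'I_N -> set 'rV[R]_d.+1)
    rad l j (F : profile R N d.+1 -> 'rV[R]_d.+1) : 0 < rad ->
  (forall i y, enorm y <= rad -> X i y) -> lipschitz_in X l j F -> 0 <= l.
Proof.
move=> rad0 Xrad lipF; pose u : 'rV[R]_d.+1 := const_mx 1.
have u0 : 0 < enorm u.
  rewrite lt_neqAle enorm_ge0 andbT eq_sym; apply/eqP => /enorm_eq0P/rowP.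
  by move=> /(_ ord0)/eqP; rewrite !mxE oner_eq0.
pose y := (rad / enorm u) *: u.
have ny : enorm y = rad.
  by rewrite enormZ gtr0_norm ?divr_gt0// divfK// gt_eqF.
have := lipF (fun=> 0) y; rewrite subr0 ny => lipF0.
rewrite -(pmulr_lge0 _ rad0); apply: le_trans (enorm_ge0 _) (lipF0 _ _).
  by move=> i; apply: Xrad; rewrite enorm0 ltW.
by apply: Xrad; rewrite ny.
Qed.

Lemma profile0_eq (R : realType) (N : nat) (x y : profile R N 0) : x = y.
Proof. by apply/funext => i; rewrite (thinmx0 (x i)) (thinmx0 (y i)). Qed.

Unset Implicit Arguments.

Theorem theorem1 (R : realType) (n : nat) (D U : R) (mu : 'I_n.+1 -> R)
    (L : 'I_n.+1 -> 'I_n.+1 -> R) (r : 'I_n.+1 -> R)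
    (hD : 0 < D) (hmu : forall i, 0 < mu i)
    (hr : quasidominance_weights mu L r) :
  0 < min_gap mu L r /\
  exists2 c : R, 0 < c &
  forall (d : nat) (rad : R) (X : 'I_n.+1 -> set 'rV[R]_d)
    (C : 'I_n.+1 -> profile R n.+1 d -> R)
    (grad : 'I_n.+1 -> profile R n.+1 d -> 'rV[R]_d),
    0 < rad ->
    action_sets rad D X ->
    (forall i x, joint X x -> is_pgradient X C i x (grad i x)) ->
    (forall i x, joint X x ->
       strongly_convex_on (X i) (mu i) (fun y => C i (upd x i y))) ->
    (forall i j, lipschitz_in X (L i j) j (grad i)) ->
    (forall i x, joint X x -> enorm (grad i x) <= U) ->
    (exists! xstar, nash X C xstar) /\
    forall xstar, nash X C xstar ->
    forall (B T : nat) (S : 'I_n.+1 -> set nat) (x : nat -> profile R n.+1 d),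
      (1 <= B)%N -> (2 * B <= T)%N ->
      (forall i, S i `<=` [set t | (1 <= t)%N]) ->
      partially_asynchronous S B ->
      async_run X grad S
        (B%:R * ln (T%:R / B%:R) / (min_gap mu L r * T%:R)) x ->
      \big[Num.max/0]_(i < n.+1) enorm (x T i - xstar i) ^+ 2 <=
        c * (B%:R ^+ 3 * ln (T%:R / B%:R) / T%:R).
Proof.
set eps := min_gap mu L r.
have r_gt0 i : 0 < r i := (hr i).1.
have eps_gt0 : 0 < eps.
  have gap_gt0 i : 0 < dominance_gap mu L r i.
    by rewrite subr_gt0 ltr_pdivrMl// (hr i).2.
  by apply: lt_bigmin.
have gap i : \sum_(j | j != i) r j * L i j <= r i * (mu i - eps).
  rewrite mulrBr lerBrDr -lerBrDl mulrC -ler_pdivlMr// mulrBl.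
  rewrite (mulrC (r i)) mulfK ?gt_eqF// (mulrC (\sum_(j | _) _)).
  exact: bigmin_le.
(* Absolute value and added 1 make the constant positive; it is fixed before the dimension and the
   sets. *)
split=> //; exists (`|rate_constant mu r eps D U| + 1).
  by rewrite ltr_wpDl.
move=> d rad X C grad rad0 setsX gradP scC lipg gU.
(* Passes from the proved factor [B] to the claimed [B ^ 3]. *)
have scaled_rate (B T : nat) : (1 <= B)%N -> (2 * B <= T)%N ->
    0 <= B%:R * ln (T%:R / B%:R) / T%:R :> R /\
    B%:R * ln (T%:R / B%:R) / T%:R <= B%:R ^+ 3 * ln (T%:R / B%:R) / T%:R :> R.
  move=> B1 BT; have B0 : 0 < B%:R :> R by rewrite ltr0n.
  have ln0 : 0 <= ln (T%:R / B%:R) :> R.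
    rewrite ln_ge0// ler_pdivlMr// mul1r ler_nat (leq_trans _ BT)//.
    by rewrite leq_pmull.
  split; first by rewrite divr_ge0// mulr_ge0.
  rewrite ler_wpM2r ?invr_ge0// ler_wpM2r// exprS ler_peMr ?ler0n//.
  by rewrite exprn_ege1// ler1n.
have bound xstar (B T : nat) (x : nat -> profile R n.+1 d) :
    (1 <= B)%N -> (2 * B <= T)%N ->
    (forall i, enorm (x T i - xstar i) ^+ 2
      <= rate_constant mu r eps D U * (B%:R * ln (T%:R / B%:R) / T%:R)) ->
    \big[Num.max/0]_(i < n.+1) enorm (x T i - xstar i) ^+ 2 <=
      (`|rate_constant mu r eps D U| + 1)
        * (B%:R ^+ 3 * ln (T%:R / B%:R) / T%:R).
  move=> B1 BT rate; have [l0 lB] := scaled_rate B T B1 BT.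
  have c0 : 0 <= `|rate_constant mu r eps D U| + 1 by rewrite addr_ge0.
  apply/bigmax_leP; split=> [|i _]; first by rewrite mulr_ge0// (le_trans l0).
  apply: le_trans (rate i) (le_trans (ler_wpM2r l0 _) (ler_wpM2l c0 lB)).
  by rewrite (le_trans (ler_norm _))// lerDl.
have joint0 : joint X (fun=> 0).
  by move=> i; have [_ _ + _] := setsX i; apply; rewrite enorm0 ltW.
(* The action spaces of dimension 0 say nothing about the sign of [L i j]. *)
case: d => [|d] in X C grad setsX gradP scC lipg gU bound joint0 *.
  split=> [|xstar _ B T S x B1 BT _ _ _].
    exists (fun=> 0); split=> [|x _]; last exact: profile0_eq.
    by split=> // i y _; rewrite (profile0_eq (upd _ i y) (fun=> 0)).
  have [l0 lB] := scaled_rate B T B1 BT.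
  have c0 : 0 <= (`|rate_constant mu r eps D U| + 1)
      * (B%:R ^+ 3 * ln (T%:R / B%:R) / T%:R).
    by rewrite mulr_ge0 ?addr_ge0// (le_trans l0).
  apply/bigmax_leP; split=> // i _.
  by rewrite (thinmx0 (x T i - xstar i)) enorm0 expr0n.
have L_ge0 i j : 0 <= L i j.
  apply: lipschitz_in_ge0 rad0 _ (lipg i j) => k y.
  by have [_ _ + _] := setsX k; apply.
split.
  have [xs nxs] := nash_exists hmu L_ge0 r_gt0 eps_gt0 gap rad0 setsX gradP scC
    lipg.
  exists xs; split=> // y ny.
  exact: (nash_unique hmu L_ge0 r_gt0 eps_gt0 gap setsX gradP scC lipg nxs ny).
move=> xstar nxs B T S x B1 BT _ SB run; apply: bound => // i.
exact: (async_run_rate hmu L_ge0 r_gt0 eps_gt0 gap setsX gradP scC lipg i gU nxs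
  B1 BT SB run).
Qed.
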